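(* Let $(B,\mathcal{A})$ be a Boolean admissibility system, and let $C_{\mathcal{A}}$ be the frame of all ideals $I\subseteq B$ such that $\bigvee R\in I$ whenever $R\in\mathcal{A}$ and $R\subseteq I$. Then the following are equivalent: (a) the frame $C_{\mathcal{A}}$ is ultranormal and $\{\downarrow b\mid b\in B\}=\mathfrak{B}(C_{\mathcal{A}})$; (b) whenever $I,J\in C_{\mathcal{A}}$, one has $\{a\vee b\mid a\in I, b\in J\}\in C_{\mathcal{A}}$.
   Context: In a poset $X$, $\downarrow x=\{y\in X\mid y\leq x\}$, and for $R,S\subseteq X$, $R\preceq S$ ($R$ refines $S$) means that for each $r\in R$ there is $s\in S$ with $r\leq s$. A Boolean admissibility system is a pair $(B,\mathcal{A})$ where $B$ is a Boolean algebra and $\mathcal{A}$ is a collection of subsets of $B$, each having a least upper bound in $B$, such that: (i) $\mathcal{A}$ contains all finite subsets of $B$; (ii) if $R\in\mathcal{A}$, $S\subseteq\downarrow\bigvee R$ and $R\preceq S$, then $S\in\mathcal{A}$; (iii) if $R\in\mathcal{A}$ and for each $r\in R$ we have $R_r\in\mathcal{A}$ with $\bigvee R_r=r$, then $\bigcup_{r\in R}R_r\in\mathcal{A}$; (iv) if $R\in\mathcal{A}$ and $a\in B$, then $\{a\wedge r\mid r\in R\}\in\mathcal{A}$. Ideals of $B$ are not required to be proper; $C_{\mathcal{A}}$ is ordered by inclusion. A frame is a complete lattice satisfying $x\wedge\bigvee_{i\in I}y_i=\bigvee_{i\in I}(x\wedge y_i)$. An element $x$ of a frame $L$ is complemented if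 there is $y\in L$ (its complement, denoted $x'$) with $x\wedge y=0$ and $x\vee y=1$; $\mathfrak{B}(L)$ denotes the set of complemented elements of $L$. A frame $L$ is zero-dimensional if $x=\bigvee\{y\in\mathfrak{B}(L)\mid y\leq x\}$ for each $x\in L$. A zero-dimensional frame $L$ is ultranormal if whenever $a\vee b=1$ there is a complemented $c\in L$ with $c\leq a$ and $c'\leq b$. (The frame $C_{\mathcal{A}}$ is zero-dimensional, and $\downarrow b\in\mathfrak{B}(C_{\mathcal{A}})$ for all $b\in B$.) *)

(* Defs.v *)
From HB Require Import structures.
From mathcomp Require Import all_boot all_order.
From mathcomp Require Import boolp classical_sets cardinality.

Set Implicit Arguments.
Unset Strict Implicit.
Unset Printing Implicit Defensive.

Import Order.Theory.

Local Open Scope classical_set_scope.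

(* Boolean algebras are rendered as [ctbDistrLatticeType]s (possibly trivial);
   [supremums R s] says that [s] is the least upper bound of [R]. *)

HB.mixin Record TBLattice_isFrame (d : Order.disp_t) L of
    Order.TBLattice d L := {
  bigjoin : set L -> L;
  bigjoin_supremums : forall S : set L, supremums S (bigjoin S);
  meet_bigjoin : forall (x : L) (S : set L),
    (x `&` bigjoin S)%O = bigjoin [set (x `&` y)%O | y in S];
}.

#[short(type="frameType")]
HB.structure Definition Frame (d : Order.disp_t) :=
  { L of TBLattice_isFrame d L & Order.TBLattice d L }.

Section FrameNotions.
Variables (d : Order.disp_t) (L : frameType d).
Implicit Types x y : L.

Definition is_complement x y : Prop :=
  (x `&` y = \bot)%O /\ (x `|` y = \top)%O.

Definition complemented : set L := [set x | exists y, is_complement x y].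

Definition zero_dimensional : Prop :=
  forall x, x = bigjoin [set y | complemented y /\ (y <= x)%O].

(* The complement of an element of a frame is unique, so [c'] is *the*
   complement of [c]. *)
Definition ultranormal : Prop :=
  zero_dimensional /\
  forall a b : L, (a `|` b = \top)%O ->
    exists c c' : L, [/\ is_complement c c', (c <= a)%O & (c' <= b)%O].

End FrameNotions.

Arguments complemented {d} L.
Arguments zero_dimensional {d} L.
Arguments ultranormal {d} L.

Definition downset (d : Order.disp_t) (X : porderType d) (x : X) : set X :=
  [set y | (y <= x)%O].

Definition refines (d : Order.disp_t) (X : porderType d) (R S : set X) : Prop :=
  forall r, R r -> exists2 s, S s & (r <= s)%O.

Record is_admissibility (d : Order.disp_t) (B : ctbDistrLatticeType d)
    (A : set (set B)) : Prop := IsAdmissibility {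
  adm_supremums : forall R, A R -> supremums R !=set0;
  adm_finite : forall R : set B, finite_set R -> A R;
  adm_refines : forall (R S : set B) (s : B), A R -> supremums R s ->
    S `<=` downset s -> refines R S -> A S;
  adm_bigcup : forall (R : set B) (F : B -> set B), A R ->
    (forall r, R r -> A (F r) /\ supremums (F r) r) ->
    A (\bigcup_(r in R) F r);
  adm_meet : forall (R : set B) (a : B), A R -> A [set (a `&` r)%O | r in R];
}.

Record admissibilitySystem (d : Order.disp_t) (B : ctbDistrLatticeType d) :=
  AdmissibilitySystem {
    adm_sets :> set (set B);
    admP : is_admissibility adm_sets;
  }.

Record is_ideal (d : Order.disp_t) (B : ctbDistrLatticeType d) (I : set B) :
    Prop := IsIdeal {
  ideal_bot : I \bot%O;
  ideal_le : forall x y : B, (x <= y)%O -> I y -> I x;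
  ideal_join : forall x y : B, I x -> I y -> I (x `|` y)%O;
}.

Definition is_cideal (d : Order.disp_t) (B : ctbDistrLatticeType d)
    (A : admissibilitySystem B) (I : set B) : Prop :=
  is_ideal I /\
  forall (R : set B) (s : B), adm_sets A R -> R `<=` I -> supremums R s -> I s.

Record cideal (d : Order.disp_t) (B : ctbDistrLatticeType d)
    (A : admissibilitySystem B) := CIdeal {
  cideal_set :> set B;
  cidealP : is_cideal A cideal_set;
}.

Fact cideal_display : Order.disp_t. Proof. exact: Order.Disp tt tt. Qed.

Section CIdealFrame.
Variables (d : Order.disp_t) (B : ctbDistrLatticeType d).
Variable A : admissibilitySystem B.
Local Notation C := (cideal A).

Lemma cideal_inj (I J : C) : (I : set B) = J -> I = J.
Proof.
case: I J => [I hI] [J hJ] /= IJ; move: hI hJ; rewrite IJ => hI hJ.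
by congr CIdeal; exact: Prop_irrelevance.
Qed.

HB.instance Definition _ := gen_eqMixin C.
HB.instance Definition _ := gen_choiceMixin C.

Definition cideal_le (I J : C) : bool := `[< (I : set B) `<=` J >].

Fact cideal_le_refl : reflexive cideal_le.
Proof. by move=> I; apply/asboolP. Qed.

Fact cideal_le_anti : antisymmetric cideal_le.
Proof.
move=> I J /andP[/asboolP IJ /asboolP JI].
by apply: cideal_inj; apply/seteqP.
Qed.

Fact cideal_le_trans : transitive cideal_le.
Proof.
move=> J I K /asboolP IJ /asboolP JK.
by apply/asboolP; exact: subset_trans JK.
Qed.

HB.instance Definition _ := Order.Le_isPOrder.Build cideal_display C
  cideal_le_refl cideal_le_anti cideal_le_trans.

Lemma cideal_leP (I J : C) : reflect ((I : set B) `<=` J) (I <= J)%O.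
Proof. exact: asboolP. Qed.

Lemma is_cideal_bigcap (P : set C) :
  is_cideal A [set b : B | forall I : C, P I -> (I : set B) b].
Proof.
split; first split.
- by move=> I _; case: (cidealP I) => -[].
- move=> x y xy hy I PI; case: (cidealP I) => -[_ le_I _] _.
  exact: le_I xy (hy I PI).
- move=> x y hx hy I PI; case: (cidealP I) => -[_ _ join_I] _.
  exact: join_I (hx I PI) (hy I PI).
move=> R s AR RI Rs I PI; case: (cidealP I) => _; apply; first exact: AR.
  by move=> r Rr; exact: RI PI.
exact: Rs.
Qed.

Definition cideal_bigcap (P : set C) : C := CIdeal (is_cideal_bigcap P).

Definition cideal_bigjoin (S : set C) : C := cideal_bigcap (ubound S).

Lemma cideal_bigjoin_supremums (S : set C) : supremums S (cideal_bigjoin S).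
Proof.
split=> [I SI|J SJ]; apply/cideal_leP => b.
  by move=> Ib J /(_ I SI) /cideal_leP; apply.
by apply.
Qed.

Definition cideal_meet (I J : C) : C := cideal_bigcap [set I; J].

Fact cideal_meetP (I J K : C) :
  (I <= cideal_meet J K)%O = (I <= J)%O && (I <= K)%O.
Proof.
apply/idP/andP => [/cideal_leP IJK|[/cideal_leP IJ /cideal_leP IK]].
  by split; apply/cideal_leP => b /IJK; apply; [left|right].
by apply/cideal_leP => b Ib _ [->|->]; [exact: IJ|exact: IK].
Qed.

Definition cideal_join (I J : C) : C := cideal_bigjoin [set I; J].

Fact cideal_joinP (I J K : C) :
  (cideal_join I J <= K)%O = (I <= K)%O && (J <= K)%O.
Proof.
have [ub lub] := cideal_bigjoin_supremums [set I; J].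
apply/idP/andP => [IJK|[IK JK]].
  by split; apply: le_trans IJK; apply: ub; [left|right].
by apply: lub => _ [->|->].
Qed.

HB.instance Definition _ := Order.POrder_MeetJoin_isLattice.Build
  cideal_display C cideal_meetP cideal_joinP.

Lemma cideal_meetE (I J : C) : ((I `&` J)%O : set B) = (I : set B) `&` J.
Proof.
rewrite -[(I `&` J)%O]/(cideal_meet I J).
apply/seteqP; split=> [b h|b [Ib Jb] _ [->|->] //].
by split; apply: h; [left|right].
Qed.

Fact cideal_botP (I : C) : (cideal_bigcap setT <= I)%O.
Proof. by apply/cideal_leP => b hb; exact: hb I Logic.I. Qed.

Fact cideal_topP (I : C) : (I <= cideal_bigcap set0)%O.
Proof. by apply/cideal_leP => b _ J []. Qed.

HB.instance Definition _ := Order.hasBottom.Build cideal_display C cideal_botP.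
HB.instance Definition _ := Order.hasTop.Build cideal_display C cideal_topP.

Lemma supremums_meet (R : set B) (a s : B) : supremums R s ->
  supremums [set (a `&` r)%O | r in R] (a `&` s)%O.
Proof.
case=> ub lub; split=> [_ [r Rr <-]|t ubt].
  by apply: leI2 => //; exact: ub.
have {}/lub : ubound R (~` a `|` t)%O.
  move=> r Rr; rewrite -[r]meet1x -(joinxC a) meetUl joinC.
  by apply: leU2; [exact: leIl|apply: ubt; exists r].
move=> /(leI2 (lexx a)) /le_trans; apply.
by rewrite meetUr meetxC join0x leIr.
Qed.

Lemma is_cideal_residual (I W : C) :
  is_cideal A [set b : B | forall a, (I : set B) a -> (W : set B) (a `&` b)%O].
Proof.
case: (cidealP W) => -[W0 W_le W_join] W_sup; split; first split.
- by move=> a _; rewrite meetx0.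
- by move=> x y xy hy a Ia; apply: W_le (hy a Ia); apply: leI2.
- by move=> x y hx hy a Ia; rewrite meetUr; apply: W_join; [exact: hx|exact: hy].
move=> R s AR RK Rs a Ia.
apply: (W_sup [set (a `&` r)%O | r in R]).
- exact: adm_meet (admP A) _ _ AR.
- by move=> _ [r Rr <-]; exact: RK.
exact: supremums_meet.
Qed.

Lemma cideal_meet_bigjoin (I : C) (S : set C) :
  (I `&` cideal_bigjoin S)%O = cideal_bigjoin [set (I `&` J)%O | J in S].
Proof.
have [ubS lubS] := cideal_bigjoin_supremums S.
set T := [set _ | _ in _].
have [ubT lubT] := cideal_bigjoin_supremums T.
apply/le_anti/andP; split; last first.
  by apply: lubT => _ [J SJ <-]; apply: leI2 => //; exact: ubS.
apply/cideal_leP; rewrite cideal_meetE => b [Ib Sb].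
have /lubS/cideal_leP/(_ b Sb)/(_ b Ib) :
    ubound S (CIdeal (is_cideal_residual I (cideal_bigjoin T))).
  move=> J SJ; apply/cideal_leP => x Jx a Ia.
  have /ubT/cideal_leP : T (I `&` J)%O by exists J.
  apply; rewrite cideal_meetE; split.
    by case: (cidealP I) => -[_ le_I _] _; apply: le_I Ia; exact: leIl.
  by case: (cidealP J) => -[_ le_J _] _; apply: le_J Jx; exact: leIr.
by rewrite meetxx.
Qed.

HB.instance Definition _ := TBLattice_isFrame.Build cideal_display C
  cideal_bigjoin_supremums cideal_meet_bigjoin.

Lemma is_cideal_downset (b : B) : is_cideal A (downset b).
Proof.
split; first split.
- exact: le0x.
- by move=> x y xy yb; exact: le_trans yb.
- by move=> x y xb yb; rewrite /downset /= leUx; apply/andP; split.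
by move=> R s _ Rb [_ lub]; apply: lub => r Rr; exact: Rb.
Qed.

Definition principal (b : B) : C := CIdeal (is_cideal_downset b).

End CIdealFrame.

Arguments principal {d B} A b.

(* Main.v *)
Require Import Defs.
From HB Require Import structures.
From mathcomp Require Import all_boot all_order.
From mathcomp Require Import boolp classical_sets cardinality.

(** Write [I + J] for the set of all joins [a `|` b] with [a] in [I] and [b] in
    [J]. It is always an ideal, contained in the join of [I] and [J] in the
    frame; it is an admissible ideal exactly when it equals that join.

    If all sums [I + J] are admissible, a cover [I `|` J = \top] gives
    [\top = a `|` b] with [a] in [I] and [b] in [J]. The principal ideals of
    [a] and of its Boolean complement, which lies below [b], then witness
    ultranormality ([cover_split]); when moreover [I] and [J] are disjoint, [I]
    must be the principal ideal of [a] ([complement_principal]).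

    Conversely, take the supremum [s] of an admissible subset of [I + J]. It
    belongs to [I `|` J], so [I `|` principal A (~` s)] and [J] cover the frame.
    Ultranormality, with all complemented elements principal, yields
    [x `|` y = \top] with [x] in [I `|` principal A (~` s)] and [y] in [J].
    Cutting down to [s] removes the extra summand, because [s `&` x] lies in [I]
    ([join_principalC_meet]); hence [s = (s `&` x) `|` (s `&` y)] lies in
    [I + J]. *)

Import Order.Theory.

Local Open Scope classical_set_scope.

Section AdmissibleIdeals.
Set Implicit Arguments.
Unset Strict Implicit.

Variables (d : Order.disp_t) (B : ctbDistrLatticeType d).
Variable A : admissibilitySystem B.
Implicit Types (I J K : cideal A) (a b s x y : B).

Lemma cideal_bot I : (I : set B) \bot%O.
Proof. by case: (cidealP I) => -[]. Qed.

Lemma cideal_down I x y : (x <= y)%O -> (I : set B) y -> (I : set B) x.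
Proof. by case: (cidealP I) => -[_ le_I _] _; exact: le_I. Qed.

Lemma cideal_joined I x y :
  (I : set B) x -> (I : set B) y -> (I : set B) (x `|` y)%O.
Proof. by case: (cidealP I) => -[_ _ join_I] _; exact: join_I. Qed.

Lemma principal_leP I b : (principal A b <= I)%O <-> (I : set B) b.
Proof.
split=> [/cideal_leP|Ib]; first by apply; exact: lexx.
by apply/cideal_leP => x xb; exact: cideal_down xb Ib.
Qed.

Lemma cideal_eqTP I : I = \top%O <-> (I : set B) \top%O.
Proof.
split=> [->|IT].
  by apply/(principal_leP \top%O); exact: lex1.
apply/eqP; rewrite eq_le lex1 /=.
by apply/cideal_leP => b _; exact: cideal_down (lex1 b) IT.
Qed.

Lemma cideal_bot_eq0 b : cideal_set (\bot%O : cideal A) b -> b = \bot%O.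
Proof.
have /cideal_leP h : (\bot%O <= principal A \bot%O)%O by exact: le0x.
by move=> /h; rewrite /= /downset /= lex0 => /eqP.
Qed.

Lemma principal_is_complement b :
  is_complement (principal A b) (principal A (~` b)%O).
Proof.
split.
  apply/eqP; rewrite -lex0; apply/cideal_leP => x.
  rewrite cideal_meetE => -[xb xb'].
  have : (x <= b `&` ~` b)%O by rewrite lexI; apply/andP.
  by rewrite meetxC lex0 => /eqP ->; exact: cideal_bot.
apply/cideal_eqTP; rewrite -(joinxC b).
by apply: cideal_joined; apply/principal_leP; [exact: leUl|exact: leUr].
Qed.

Lemma cideal_zero_dimensional : zero_dimensional (cideal A).
Proof.
move=> I; set S := [set _ | _].
have [ub lub] : supremums S (bigjoin S) by exact: bigjoin_supremums.
apply/eqP; rewrite eq_le; apply/andP; split; last by apply: lub => J [].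
apply/cideal_leP => b /principal_leP Ib; apply/principal_leP; apply: ub.
by split=> //; exists (principal A (~` b)%O); exact: principal_is_complement.
Qed.

Definition ideal_sum I J : set B :=
  [set (a `|` b)%O | a in (I : set B) & b in (J : set B)].

(** Downward closure is where distributivity enters: an element below
    [a `|` b] is the join of its meets with [a] and with [b]. *)
Lemma is_ideal_sum I J : is_ideal (ideal_sum I J).
Proof.
split.
- exists \bot%O; first exact: cideal_bot.
  by exists \bot%O; [exact: cideal_bot|exact: joinxx].
- move=> x y xy [a Ia [b Jb aby]]; exists (x `&` a)%O.
    by apply: cideal_down Ia; exact: leIr.
  exists (x `&` b)%O; first by apply: cideal_down Jb; exact: leIr.
  by rewrite -meetUr aby; apply/meet_idPl.
- move=> _ _ [a Ia [b Jb <-]] [a' Ia' [b' Jb' <-]].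
  exists (a `|` a')%O; first exact: cideal_joined.
  by exists (b `|` b')%O; [exact: cideal_joined|rewrite joinACA].
Qed.

Lemma ideal_sum_sub_join I J : ideal_sum I J `<=` cideal_set (I `|` J)%O.
Proof.
move=> _ [a Ia [b Jb <-]]; apply: cideal_joined; apply/principal_leP.
  by apply: le_trans (leUl I J); apply/principal_leP.
by apply: le_trans (leUr J I); apply/principal_leP.
Qed.

Lemma join_sub_ideal_sum I J : is_cideal A (ideal_sum I J) ->
  cideal_set (I `|` J)%O `<=` ideal_sum I J.
Proof.
move=> sumIJ; suff /cideal_leP : (I `|` J <= CIdeal sumIJ)%O by [].
rewrite leUx; apply/andP; split; apply/cideal_leP => x Hx.
  by exists x => //; exists \bot%O; [exact: cideal_bot|exact: joinx0].
by exists \bot%O; [exact: cideal_bot|exists x => //; exact: join0x].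
Qed.

(** A cover of the frame already covers the top element of the Boolean algebra,
    where one of the two pieces may be traded for a complement of the other. *)
Lemma cover_split I J : is_cideal A (ideal_sum I J) -> (I `|` J = \top)%O ->
  exists2 a, (I : set B) a & (J : set B) (~` a)%O.
Proof.
move=> sumIJ /cideal_eqTP /(join_sub_ideal_sum sumIJ) [a Ia [b Jb abT]].
exists a => //; apply: cideal_down Jb.
by rewrite -[(~` a)%O]meetx1 -abT meetUr meetCx join0x leIr.
Qed.

Lemma complement_principal I J : is_cideal A (ideal_sum I J) ->
  is_complement I J -> exists a, principal A a = I.
Proof.
move=> sumIJ [IJ0 /(cover_split sumIJ) [a Ia Ja']]; exists a.
apply/eqP; rewrite eq_le; apply/andP; split; first exact/principal_leP.
apply/cideal_leP => x Ix; rewrite /= /downset /=.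
have /cideal_bot_eq0 xa'0 : cideal_set (\bot%O : cideal A) (x `&` ~` a)%O.
  rewrite -IJ0 cideal_meetE; split; first by apply: cideal_down Ix; exact: leIl.
  by apply: cideal_down Ja'; exact: leIr.
by rewrite -[x]meetx1 -(joinxC a) meetUr xa'0 joinx0 leIr.
Qed.

(** The elements whose traces below [s] all lie in [I] form an admissible ideal,
    the residual of [principal A s] in [I], which contains both summands. *)
Lemma join_principalC_meet I s x :
  cideal_set (I `|` principal A (~` s)%O)%O x -> (I : set B) (s `&` x)%O.
Proof.
have /cideal_leP h : (I `|` principal A (~` s)%O <=
    CIdeal (is_cideal_residual (principal A s) I))%O.
  rewrite leUx; apply/andP; split; apply/cideal_leP => y Hy a a_s.
    by apply: cideal_down Hy; exact: leIr.
  have /eqP -> : (a `&` y)%O == \bot%O.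
    by rewrite -lex0 -(meetxC s); apply: leI2.
  exact: cideal_bot.
by move=> /h; apply; exact: lexx.
Qed.

Lemma ultranormal_join_sub_ideal_sum I J :
  ultranormal (cideal A) ->
  complemented (cideal A) `<=` range (principal A) ->
  cideal_set (I `|` J)%O `<=` ideal_sum I J.
Proof.
move=> [_ splitT] compl s IJs.
have coverT : ((I `|` principal A (~` s)%O) `|` J = \top)%O.
  rewrite joinAC; apply/cideal_eqTP; rewrite -(joinxC s).
  apply: cideal_joined; apply/principal_leP; last exact: leUr.
  by apply: le_trans (leUl _ _); apply/principal_leP.
have [c [c' [[cc'0 cc'T] cI c'J]]] := splitT _ _ coverT.
have [x _ xc] : range (principal A) c by apply: compl; exists c'.
have [y _ yc'] : range (principal A) c'.
  by apply: compl; exists c; rewrite /is_complement meetC joinC.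
have xyT : (x `|` y = \top)%O.
  have /cideal_leP/(_ \top%O) : (c `|` c' <= principal A (x `|` y)%O)%O.
    rewrite leUx -xc -yc'.
    by apply/andP; split; apply/principal_leP; [exact: leUl|exact: leUr].
  have /cideal_eqTP cT := cc'T.
  by move=> /(_ cT); rewrite /= /downset /= le1x => /eqP.
exists (s `&` x)%O.
  by apply/join_principalC_meet/principal_leP; rewrite xc.
exists (s `&` y)%O; last by rewrite -meetUr xyT meetx1.
by apply: (cideal_down (leIr y s)); apply/principal_leP; rewrite yc'.
Qed.

End AdmissibleIdeals.

Theorem theorem21 (d : Order.disp_t) (B : ctbDistrLatticeType d)
    (A : admissibilitySystem B) :
  (ultranormal (cideal A) /\
   [set principal A b | b in [set: B]] = complemented (cideal A))
  <->
  (forall I J : cideal A,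
     is_cideal A [set (a `|` b)%O | a in (I : set B) & b in (J : set B)]).
Proof.
split=> [[ultra compl] I J|sum_cideal].
  split; first exact: is_ideal_sum.
  move=> R s AR RIJ Rs.
  apply: (ultranormal_join_sub_ideal_sum ultra); first by rewrite compl.
  case: (cidealP (I `|` J)%O) => _; apply; [exact: AR| |exact: Rs].
  by apply: subset_trans RIJ _; exact: ideal_sum_sub_join.
split; first split; first exact: cideal_zero_dimensional.
  move=> I J /(cover_split (sum_cideal I J)) [a Ia Ja'].
  exists (principal A a), (principal A (~` a)%O).
  by split; [exact: principal_is_complement|apply/principal_leP..].
apply/seteqP; split=> [_ [b _ <-]|I [J IJ]].
  by exists (principal A (~` b)%O); exact: principal_is_complement.
have [a aI] := complement_principal (sum_cideal I J) IJ.
by exists a.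
Qed.
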